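(* Let $n,m,q,L\ge1$, $c>0$, and let $X\in\mathbb{R}^{n\times L}$, $U\in\mathbb{R}^{m\times L}$, $V\in\mathbb{R}^{q\times L}$, $E\in\mathbb{R}^{n\times q}$, $\mathcal{D}_{11}\in\mathbb{R}^{L\times L}$ be given. Define $N_c=\begin{bmatrix}I_n & X\mathcal{D}_{11}-EV\\ 0&-X\\0&-U\end{bmatrix}\begin{bmatrix}cI_n&0\\0&-I_L\end{bmatrix}\begin{bmatrix}I_n & X\mathcal{D}_{11}-EV\\ 0&-X\\0&-U\end{bmatrix}^{T}$ and the set $\Sigma=\{(A,B)\in\mathbb{R}^{n\times n}\times\mathbb{R}^{n\times m}: \begin{bmatrix}I_n&A&B\end{bmatrix}N_c\begin{bmatrix}I_n&A&B\end{bmatrix}^{T}\ge0\}$ (equivalently, $W:=X\mathcal{D}_{11}-AX-BU-EV$ satisfies $WW^T\le cI_n$). Suppose the true system matrices $(\bar A,\bar B)$ satisfy $\begin{bmatrix}I_n&\bar A&\bar B\end{bmatrix}N_c\begin{bmatrix}I_n&\bar A&\bar B\end{bmatrix}^{T}>0$. Then the data $(X,U)$ are informative for quadratic stabilization if and only if there exist $\alpha\ge0$, $\beta>0$, $P=P^T>0$ in $\mathbb{R}^{n\times n}$ and $\mathcal{J}\in\mathbb{R}^{m\times n}$ such that $\begin{bmatrix}-\beta I_n&-P&-\mathcal{J}^{T}\\-P&0&0\\-\mathcal{J}&0&0\end{bmatrix}-\alpha N_c\ge0.$ Moreover, if $P,\mathcal{J}$ satisfy this inequality, then $K=\mathcal{J}P^{-1}$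 is a quadratically stabilizing gain, i.e. $(A+BK)^TP^{-1}+P^{-1}(A+BK)<0$ for all $(A,B)\in\Sigma$.
   Context: The data come from an agent $\dot x=\bar Ax+\bar Bu+Ev$ with unknown $(\bar A,\bar B)$: $X,U,V$ are the first $L$ coefficients of $x,u,v$ in a Chebyshev orthogonal polynomial basis, $\mathcal{D}_{11}$ is the leading $L\times L$ block of the basis differentiation matrix, and the truncation error enters as an unknown noise $W$ with $X\mathcal{D}_{11}=\bar AX+\bar BU+EV+W$ and $WW^T\le cI_n$, so $(\bar A,\bar B)\in\Sigma$. The data $(X,U)$ are informative for quadratic stabilization if there exist $K\in\mathbb{R}^{m\times n}$ and $Q=Q^T>0$ such that $(A+BK)^TQ+Q(A+BK)<0$ for all $(A,B)\in\Sigma$. Matrix inequalities refer to symmetric matrices in the Loewner order. *)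

(* Defs.v *)
From HB Require Import structures.
From mathcomp Require Import all_boot all_order all_algebra.
Set Implicit Arguments. Unset Strict Implicit. Unset Printing Implicit Defensive.
Import Order.TTheory GRing.Theory Num.Theory.
Local Open Scope ring_scope.

Definition symmx (R : realFieldType) k (M : 'M[R]_k) : Prop := M^T = M.

Definition psdmx (R : realFieldType) k (M : 'M[R]_k) : Prop :=
  symmx M /\ forall x : 'cV[R]_k, 0 <= (x^T *m M *m x) 0 0.

Definition pdmx (R : realFieldType) k (M : 'M[R]_k) : Prop :=
  symmx M /\ forall x : 'cV[R]_k, x != 0 -> 0 < (x^T *m M *m x) 0 0.

Definition ndmx (R : realFieldType) k (M : 'M[R]_k) : Prop := pdmx (- M).

Definition Nc (R : realFieldType) (n m q L : nat) (c : R)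
  (X : 'M[R]_(n, L)) (U : 'M[R]_(m, L)) (V : 'M[R]_(q, L))
  (E : 'M[R]_(n, q)) (D11 : 'M[R]_L) : 'M[R]_(n + (n + m)) :=
  let F : 'M[R]_(n + (n + m), n + L) :=
    col_mx (row_mx 1%:M (X *m D11 - E *m V))
           (col_mx (row_mx 0 (- X)) (row_mx 0 (- U))) in
  F *m block_mx (c%:M) 0 0 (- 1%:M) *m F^T.

Definition IAB (R : realFieldType) (n m : nat) (A : 'M[R]_n) (B : 'M[R]_(n, m))
  : 'M[R]_(n, n + (n + m)) := row_mx 1%:M (row_mx A B).

Definition Sigma (R : realFieldType) (n m q L : nat) (c : R)
  (X : 'M[R]_(n, L)) (U : 'M[R]_(m, L)) (V : 'M[R]_(q, L))
  (E : 'M[R]_(n, q)) (D11 : 'M[R]_L) (A : 'M[R]_n) (B : 'M[R]_(n, m)) : Prop :=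
  psdmx (IAB A B *m Nc c X U V E D11 *m (IAB A B)^T).

Definition informative_qs (R : realFieldType) (n m q L : nat) (c : R)
  (X : 'M[R]_(n, L)) (U : 'M[R]_(m, L)) (V : 'M[R]_(q, L))
  (E : 'M[R]_(n, q)) (D11 : 'M[R]_L) : Prop :=
  exists (K : 'M[R]_(m, n)) (Q : 'M[R]_n), pdmx Q /\
    forall A B, Sigma c X U V E D11 A B ->
      ndmx ((A + B *m K)^T *m Q + Q *m (A + B *m K)).

Definition LMI (R : realFieldType) (n m q L : nat) (c : R)
  (X : 'M[R]_(n, L)) (U : 'M[R]_(m, L)) (V : 'M[R]_(q, L))
  (E : 'M[R]_(n, q)) (D11 : 'M[R]_L) (alpha beta : R)
  (P : 'M[R]_n) (J : 'M[R]_(m, n)) : 'M[R]_(n + (n + m)) :=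
  block_mx (- (beta%:M)) (row_mx (- P) (- J^T)) (col_mx (- P) (- J)) 0
  - alpha *: Nc c X U V E D11.

(* Main.v *)
(* Write W = Y - G Z with Y = X D11 - E V, Z = [X; U] and G = [A B].  Adding to G a
   matrix that vanishes on the range of Z leaves W unchanged, so a common
   Lyapunov certificate forces [P; J] = Z D, and Z may be replaced by a matrix of
   full row rank.  A pair (x, w) with x nonzero on which the data form is
   nonnegative is of the shape (x, G^T x) with G in Sigma (complete the square
   and take a rank-one correction), so quadratic stabilization becomes an
   implication between two quadratic forms, to which the strict S-lemma applies
   once to get alpha and a second time to get beta.  Since R is only a real
   closed field, compactness and separation are unavailable; the S-lemma is
   obtained instead by simultaneously diagonalizing the two forms, after which
   alpha has to be chosen in a gap between two finite sets. *)
Require Import Defs.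
From HB Require Import structures.
From mathcomp Require Import all_boot all_order all_algebra.
From mathcomp Require Import complex ring lra.
Import Order.TTheory GRing.Theory Num.Theory.
Local Open Scope ring_scope.
Set Implicit Arguments.
Unset Strict Implicit.

(** * Bilinear forms given by matrices, and their algebra *)

Definition bform (R : pzRingType) p k (M : 'M[R]_(p, k)) (x : 'cV_p) (y : 'cV_k) : R :=
  (x^T *m M *m y) 0 0.

Section BilinearForms.
Variable R : comNzRingType.

Lemma bformDl p k (M : 'M[R]_(p, k)) x y z :
  bform M (x + y) z = bform M x z + bform M y z.
Proof. by rewrite /bform linearD /= !mulmxDl mxE. Qed.

Lemma bformDr p k (M : 'M[R]_(p, k)) x y z :
  bform M x (y + z) = bform M x y + bform M x z.
Proof. by rewrite /bform mulmxDr mxE. Qed.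

Lemma bformZl p k (M : 'M[R]_(p, k)) a x y : bform M (a *: x) y = a * bform M x y.
Proof. by rewrite /bform linearZ /= -!scalemxAl mxE. Qed.

Lemma bformZr p k (M : 'M[R]_(p, k)) a x y : bform M x (a *: y) = a * bform M x y.
Proof. by rewrite /bform -scalemxAr mxE. Qed.

Lemma bformDm p k (M N : 'M[R]_(p, k)) x y :
  bform (M + N) x y = bform M x y + bform N x y.
Proof. by rewrite /bform mulmxDr mulmxDl mxE. Qed.

Lemma bformZm p k a (M : 'M[R]_(p, k)) x y : bform (a *: M) x y = a * bform M x y.
Proof. by rewrite /bform -scalemxAr -scalemxAl mxE. Qed.

Lemma bformNm p k (M : 'M[R]_(p, k)) x y : bform (- M) x y = - bform M x y.
Proof. by rewrite -scaleN1r bformZm mulN1r. Qed.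

Lemma bformBm p k (M N : 'M[R]_(p, k)) x y :
  bform (M - N) x y = bform M x y - bform N x y.
Proof. by rewrite bformDm bformNm. Qed.

Lemma bform0l p k (M : 'M[R]_(p, k)) y : bform M 0 y = 0.
Proof. by rewrite /bform linear0 !mul0mx mxE. Qed.

Lemma bform_tr p k (M : 'M[R]_(p, k)) x y : bform M^T x y = bform M y x.
Proof.
rewrite /bform -[LHS]trace_mx11 -[RHS]trace_mx11 -[RHS]mxtrace_tr.
by rewrite !trmx_mul trmxK mulmxA.
Qed.

Lemma bform_mul p k p' k' (S : 'M[R]_(p, p')) (M : 'M_(p', k')) (T : 'M_(k', k)) x y :
  bform (S *m M *m T) x y = bform M (S^T *m x) (T *m y).
Proof. by rewrite /bform trmx_mul trmxK !mulmxA. Qed.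

Lemma bform_mulr p k k' (M : 'M[R]_(p, k')) (T : 'M_(k', k)) x y :
  bform (M *m T) x y = bform M x (T *m y).
Proof. by rewrite /bform !mulmxA. Qed.

Lemma bform_block p1 p2 k1 k2 (A : 'M[R]_(p1, k1)) (B : 'M_(p1, k2))
    (C : 'M_(p2, k1)) (D : 'M_(p2, k2)) x1 x2 y1 y2 :
  bform (block_mx A B C D) (col_mx x1 x2) (col_mx y1 y2) =
  bform A x1 y1 + bform B x1 y2 + bform C x2 y1 + bform D x2 y2.
Proof.
rewrite /bform -mulmxA mul_block_col tr_col_mx mul_row_col !mulmxDr !mulmxA.
by rewrite !mxE !addrA.
Qed.

End BilinearForms.

(** * Positivity of quadratic forms over a real closed field *)

Section SLemma.
Variable R : rcfType.

Lemma pdmxP k (M : 'M[R]_k) :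
  pdmx M <-> symmx M /\ forall x : 'cV_k, x != 0 -> 0 < bform M x x.
Proof. by []. Qed.

Lemma bform_diag_gt0 k (d : 'rV[R]_k) (x : 'cV_k) :
  (forall i, 0 < d 0 i) -> x != 0 -> 0 < bform (diag_mx d) x x.
Proof.
move=> d_gt0 xn0; rewrite /bform -mulmxA mul_diag_mx mxE.
have Dx i : x^T 0 i * (\matrix_(i, j) (d 0 i * x i j)) i 0 = d 0 i * x i 0 ^+ 2.
  by rewrite !mxE; ring.
under eq_bigr do rewrite Dx.
have term_ge0 i : 0 <= d 0 i * x i 0 ^+ 2 by rewrite mulr_ge0 ?sqr_ge0 ?ltW.
rewrite lt0r sumr_ge0 ?andbT //.
apply: contraNneq xn0 => /eqP; rewrite psumr_eq0 // => /allP x0.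
apply/eqP/matrixP => i j; rewrite ord1 mxE; apply/eqP.
have := implyP (x0 i (mem_index_enum _)) isT.
by rewrite mulf_eq0 sqrf_eq0 gt_eqF.
Qed.

Lemma bform1_gt0 k (x : 'cV[R]_k) : x != 0 -> 0 < bform 1%:M x x.
Proof. by rewrite -diag_const_mx; apply: bform_diag_gt0 => i; rewrite mxE. Qed.

Lemma bform1_ge0 k (x : 'cV[R]_k) : 0 <= bform 1%:M x x.
Proof. by have [->|/bform1_gt0/ltW//] := eqVneq x 0; rewrite bform0l. Qed.

Lemma bform_symC k (M : 'M[R]_k) x y : symmx M -> bform M x y = bform M y x.
Proof. by move=> sM; rewrite -bform_tr sM. Qed.

(** * Eigenvectors of a definite pencil and simultaneous diagonalization *)

Local Open Scope complex_scope.

(** This is [A z = (a + i b) z] with [z = u + i v], split into real and imaginary parts. Library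
    eigenvectors are rows, so the proof takes an eigenvector of [A^T] over [R[i]] and transposes
    it. *)
Lemma complex_eigenvector n (A : 'M[R]_n) : (0 < n)%N ->
  exists a b (u v : 'cV[R]_n),
    [/\ (u != 0) || (v != 0), A *m u = a *: u - b *: v & A *m v = b *: u + a *: v].
Proof.
move=> n_gt0; pose toC := real_complex R.
have [al /eigenvalueP[z zA zn0]] := eigenvalue_closed (map_mx toC A^T) n_gt0.
pose u := map_mx (@complex.Re R) z; pose v := map_mx (@complex.Im R) z.
have Dz : z = map_mx toC u + 'i *: map_mx toC v.
  by apply/matrixP => i j; rewrite !mxE -complexE.
exists (complex.Re al), (complex.Im al), u^T, v^T.
have zAE : z *m map_mx toC A^T =
    map_mx toC (u *m A^T) + 'i *: map_mx toC (v *m A^T).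
  by rewrite {1}Dz mulmxDl -scalemxAl !map_mxM.
have key i j : ((u *m A^T) i j == complex.Re al * u i j - complex.Im al * v i j)
    && ((v *m A^T) i j == complex.Im al * u i j + complex.Re al * v i j).
  move: zA; rewrite zAE => /matrixP/(_ i j); rewrite !mxE.
  move: (\sum_j0 _) (\sum_j0 _) => s t.
  case: (al) (z i j) => a b [c d] /eqP; rewrite eq_complex /=.
  by rewrite !mul0r !mul1r subr0 addr0 !add0r [a * d + _]addrC.
clearbody u v; split.
- apply: contraNT zn0; rewrite negb_or !negbK => /andP[/eqP u0 /eqP v0].
  by rewrite Dz -[u]trmxK -[v]trmxK u0 v0 !(trmx0, map_mx0) scaler0 addr0.
- apply: trmx_inj; rewrite trmx_mul linearB !linearZ !trmxK /=.
  apply/matrixP => i j; have /andP[/eqP E _] := key i j.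
  by rewrite E !mxE mulrN.
- apply: trmx_inj; rewrite trmx_mul linearD !linearZ !trmxK /=.
  apply/matrixP => i j; have /andP[_ /eqP E] := key i j.
  by rewrite E !mxE.
Qed.

(** If [b] were nonzero, symmetry of [F] would force [G v v = - G u u]. On the plane of [u] and [v]
    both forms are then real combinations of the real and imaginary parts of [(x + i y)^2]. Since
    complex square roots exist, a zero of [G] can be found where [F] is not positive. *)
Lemma definite_pencil_eigenvalue_real n (F G : 'M[R]_n) a b (u v : 'cV_n) :
    symmx F -> symmx G ->
    (forall x : 'cV_n, x != 0 -> bform G x x = 0 -> 0 < bform F x x) ->
    (u != 0) || (v != 0) ->
    F *m u = a *: (G *m u) - b *: (G *m v) ->
    F *m v = b *: (G *m u) + a *: (G *m v) -> b = 0.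
Proof.
move=> sF sG FG uv0 Fu Fv; apply/eqP/negPn/negP => bn0.
have Fxu x : bform F x u = a * bform G x u - b * bform G x v.
  by rewrite /bform -!mulmxA Fu mulmxBr -!scalemxAr !mxE.
have Fxv x : bform F x v = b * bform G x u + a * bform G x v.
  by rewrite /bform -!mulmxA Fv mulmxDr -!scalemxAr !mxE.
set p := bform G u u; set q := bform G u v.
have qE : bform G v u = q by rewrite bform_symC.
have pE : bform G v v = - p.
  have := bform_symC u v sF; rewrite Fxu Fxv qE -/p -/q => E.
  by apply: (mulfI bn0); lra.
have Gxy x y : bform G (x *: u + y *: v) (x *: u + y *: v) =
    p * (x ^+ 2 - y ^+ 2) + q * (2 * (x * y)).
  rewrite !(bformDl, bformDr, bformZl, bformZr) qE pE -/p -/q; ring.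
have Fxy x y : bform F (x *: u + y *: v) (x *: u + y *: v) =
    (a * p - b * q) * (x ^+ 2 - y ^+ 2) + (b * p + a * q) * (2 * (x * y)).
  rewrite !(bformDl, bformDr, bformZl, bformZr) !Fxu !Fxv qE pE -/p -/q; ring.
(* When [p = q = 0], both forms vanish at [u] and at [v], one of which is nonzero. *)
have [pq0|pq0] := eqVneq (p ^+ 2 + q ^+ 2) 0.
  have [p0 q0] : p = 0 /\ q = 0.
    move/eqP: pq0; rewrite paddr_eq0 ?sqr_ge0 // !sqrf_eq0.
    by case/andP => /eqP -> /eqP ->.
  have Gu0 : bform G u u = 0 by [].
  have Gv0 : bform G v v = 0 by rewrite pE p0 oppr0.
  case/orP: uv0 => w0.
  - by have := FG _ w0 Gu0; rewrite Fxu -/p -/q p0 q0 !mulr0 subr0 ltxx.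
  - by have := FG _ w0 Gv0; rewrite Fxv qE pE p0 q0 oppr0 !mulr0 addr0 ltxx.
(* If (x + i y)^2 = s (q - i p) then G vanishes at x u + y v, and F takes there
   the value - s b (p^2 + q^2), which is negative for s = b. *)
pose z := sqrtc ((b * q) +i* (- (b * p))).
have := sqr_sqrtc ((b * q) +i* (- (b * p))); rewrite -/z.
case: z => x y /eqP; rewrite expr2 eq_complex /= => /andP[/eqP zR /eqP zI].
have xyR : x ^+ 2 - y ^+ 2 = b * q by rewrite -zR; ring.
have xyI : 2 * (x * y) = - (b * p) by rewrite -zI; ring.
set w := x *: u + y *: v.
have Gw : bform G w w = 0 by rewrite Gxy xyR xyI; ring.
have Fw : bform F w w < 0.
  have -> : bform F w w = - (b ^+ 2 * (p ^+ 2 + q ^+ 2)).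
    by rewrite Fxy xyR xyI; ring.
  rewrite oppr_lt0 mulr_gt0 // lt0r ?sqrf_eq0 ?bn0 ?sqr_ge0 //.
  by rewrite pq0 addr_ge0 ?sqr_ge0.
have wn0 : w != 0 by apply: contraTneq Fw => ->; rewrite bform0l ltxx.
by have := lt_trans Fw (FG w wn0 Gw); rewrite ltxx.
Qed.

(** The eigenvalue is kept as a pair [(a, b)] so that a singular [G] is covered: a kernel vector of
    [G] gives [b = 0] and [w = F x]. Otherwise [x] is an eigenvector of [G^-1 F] and [w = G x]. The
    condition on [x^T w] says that [x] lies off the hyperplane orthogonal to [w]. *)
Lemma definite_pencil_eigenvector n (F G : 'M[R]_n) :
    (0 < n)%N -> symmx F -> symmx G ->
    (forall x : 'cV_n, x != 0 -> bform G x x = 0 -> 0 < bform F x x) ->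
  exists (x w : 'cV_n) a b,
    [/\ F *m x = a *: w, G *m x = b *: w & (x^T *m w) 0 0 != 0].
Proof.
move=> n_gt0 sF sG FG; have [uG|] := boolP (G \in unitmx); last first.
  rewrite -unitmx_tr -row_free_unit -kermx_eq0 => /rowV0Pn[y /sub_kermxP yG yn0].
  have Gx0 : G *m y^T = 0 by rewrite -[LHS]trmxK trmx_mul trmxK yG trmx0.
  exists y^T, (F *m y^T), 1, 0; rewrite scale1r scale0r; split=> //.
  rewrite mulmxA lt0r_neq0 // FG ?trmx_eq0 //.
  by rewrite /bform -mulmxA Gx0 mulmx0 mxE.
have [a [b [u [v [uv0 Au Av]]]]] := complex_eigenvector (invmx G *m F) n_gt0.
have Fu : F *m u = a *: (G *m u) - b *: (G *m v).
  by rewrite -(mulKVmx uG (F *m u)) [invmx G *m _]mulmxA Au mulmxBr -!scalemxAr.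
have Fv : F *m v = b *: (G *m u) + a *: (G *m v).
  by rewrite -(mulKVmx uG (F *m v)) [invmx G *m _]mulmxA Av mulmxDr -!scalemxAr.
have b0 := definite_pencil_eigenvalue_real sF sG FG uv0 Fu Fv.
have [x xn0 Fx] : exists2 x : 'cV_n, x != 0 & F *m x = a *: (G *m x).
  case/orP: uv0 => w0; [exists u | exists v] => //.
    by rewrite Fu b0 scale0r subr0.
  by rewrite Fv b0 scale0r add0r.
exists x, (G *m x), a, 1; rewrite scale1r; split=> //.
apply/eqP; rewrite mulmxA => Gxx; have := FG x xn0 Gxx.
by rewrite /bform -mulmxA Fx -scalemxAr mxE mulmxA Gxx mulr0 ltxx.
Qed.

(** The columns of [B] form a basis of the hyperplane orthogonal to [w], and [x] lies outside it. *)
Lemma col_complement n (x w : 'cV[R]_n.+1) : (x^T *m w) 0 0 != 0 ->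
  exists B : 'M[R]_(n.+1, n), row_mx x B \in unitmx /\ w^T *m B = 0.
Proof.
move=> xw; have wn0 : w != 0 by apply: contraNneq xw => ->; rewrite mulmx0 mxE.
(* Since [w^T] has rank 1, [w^T C] is supported on the first coordinate, so [w^T] kills every later
   column of [C]. *)
pose E := row_ebase w^T; pose C : 'M_(n.+1, 1 + n) := invmx E.
have r1 : \rank w^T = 1 by rewrite rank_rV trmx_eq0 wn0.
have wC : w^T *m C = col_ebase w^T *m pid_mx 1.
  by rewrite -[in LHS](mulmx_ebase w^T) r1 mulmxK ?row_ebase_unit.
have wB : w^T *m rsubmx C = 0.
  rewrite -[C]hsubmxK mul_mx_row in wC.
  move/(congr1 (@rsubmx _ 1 1 n)): wC; rewrite row_mxKr => ->.
  apply/matrixP => i j; rewrite ord1 !mxE big_ord1 mxE /= mulr0n mulr0 //.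
exists (rsubmx C); split=> //.
rewrite -unitmx_tr -row_free_unit -kermx_eq0; apply/rowV0P => y /sub_kermxP.
move/(congr1 trmx); rewrite trmx_mul trmxK trmx0 => yB.
have {yB} : row_mx x (rsubmx C) *m (y^T : 'cV_(1 + n)) = 0 by [].
rewrite -(vsubmxK (y^T : 'cV_(1 + n))); set y1 := usubmx _; set y2 := dsubmx _.
rewrite mul_row_col => yB.
have y10 : y1 = 0.
  have := congr1 (mulmx w^T) yB; rewrite mulmxDr mulmx0 !mulmxA wB mul0mx addr0.
  rewrite [y1]mx11_scalar mul_mx_scalar => /matrixP/(_ 0 0)/eqP.
  rewrite mxE [X in _ == X]mxE mulf_eq0.
  have -> : (w^T *m x) 0 0 = (x^T *m w) 0 0.
    by rewrite -[w in RHS]trmxK -trmx_mul [RHS]mxE.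
  rewrite (negPf xw) orbF => /eqP->.
  by rewrite raddf0.
have y20 : y2 = 0.
  move: yB; rewrite y10 mulmx0 add0r => yB.
  have : C *m col_mx (0 : 'cV_1) y2 = 0.
    by rewrite -[C]hsubmxK mul_row_col mulmx0 add0r.
  move/(congr1 (mulmx E)); rewrite mulmx0 mulmxA mulmxV ?row_ebase_unit //.
  by rewrite mul1mx => /(congr1 (@dsubmx _ 1 n 1)); rewrite col_mxKd linear0.
have : (y^T : 'cV_(1 + n)) = 0.
  by rewrite -(vsubmxK (y^T : 'cV_(1 + n))) -/y1 -/y2 y10 y20 col_mx0.
by move/(congr1 trmx); rewrite trmxK trmx0.
Qed.

(** Both [F x] and [G x] are multiples of [w], so [x] is orthogonal for both forms to the hyperplane
    orthogonal to [w]. Both forms split there, and the hypothesis passes to the hyperplane, where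
    induction applies. *)
Lemma simultaneous_diagonalization n (F G : 'M[R]_n) :
    symmx F -> symmx G ->
    (forall x : 'cV_n, x != 0 -> bform G x x = 0 -> 0 < bform F x x) ->
  exists (P : 'M_n) (d e : 'rV_n),
    [/\ P \in unitmx, P^T *m F *m P = diag_mx d & P^T *m G *m P = diag_mx e].
Proof.
elim: n F G => [|n IH] F G sF sG FG.
  by exists 1%:M, 0, 0; rewrite unitmx1; split=> //; apply/matrixP => -[].
have [x [w [a [b [Fx Gx xw]]]]] := definite_pencil_eigenvector (ltn0Sn n) sF sG FG.
have [B [uB wB]] := col_complement xw.
set T := row_mx x B in uB.
have split_form (M : 'M_n.+1) c : symmx M -> M *m x = c *: w ->
    T^T *m M *m T = block_mx (c *: (x^T *m w)) 0 0 (B^T *m M *m B).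
  move=> sM Mx; rewrite tr_row_mx mul_col_mx mul_col_row.
  have xM : x^T *m M = c *: w^T by rewrite -[LHS]trmxK trmx_mul trmxK sM Mx linearZ.
  rewrite -!(mulmxA _ M x) Mx -!scalemxAr xM -scalemxAl wB scaler0.
  by rewrite -[B^T *m w]trmxK trmx_mul trmxK wB trmx0 scaler0.
have sym_restr (M : 'M_n.+1) : symmx M -> symmx (B^T *m M *m B).
  by move=> sM; rewrite /symmx !trmx_mul trmxK sM mulmxA.
have Bn0 (y : 'cV_n) : y != 0 -> B *m y != 0.
  apply: contraNneq => By; have : T *m (col_mx (0 : 'cV_1) y : 'cV_n.+1) = 0.
    by rewrite mul_row_col mulmx0 add0r.
  move/(congr1 (mulmx (invmx T))); rewrite mulKmx // mulmx0.
  by move/(congr1 (@dsubmx _ 1 n 1)); rewrite col_mxKd linear0 => ->.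
have [|P [d [e [uP PF PG]]]] := IH _ _ (sym_restr _ sF) (sym_restr _ sG).
  by move=> y y0; rewrite !bform_mul trmxK; apply/FG/Bn0.
pose S : 'M_(1 + n) := block_mx 1%:M 0 0 P.
have diagS (M : 'M_n.+1) c (h : 'rV_n) : symmx M -> M *m x = c *: w ->
    P^T *m (B^T *m M *m B) *m P = diag_mx h ->
    (T *m S)^T *m M *m (T *m S) =
    diag_mx (row_mx (c *: (x^T *m w)) h : 'rV_(1 + n)).
  move=> sM Mx PM; rewrite trmx_mul -!mulmxA (mulmxA T^T) (mulmxA _ T).
  rewrite (split_form _ _ sM Mx) (tr_block_mx 1) !mulmx_block.
  rewrite !(trmx0, mul0mx, mulmx0, addr0, add0r, trmx1, mul1mx, mulmx1) mulmxA PM.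
  by rewrite diag_mx_row [_ *: _ in LHS]mx11_scalar [diag_mx (_ *: _)]mx11_scalar !mxE.
exists (T *m S), (row_mx (a *: (x^T *m w)) d), (row_mx (b *: (x^T *m w)) e).
split; [|exact: diagS|exact: diagS].
have uS : S \in unitmx by rewrite unitmxE det_ublock det1 mul1r -unitmxE.
by rewrite unitmx_mul uB uS.
Qed.

(** * Separation of finite sets and the strict S-lemma *)

Lemma seq_gap (m : R) (t : seq R) : (forall b, b \in t -> m < b) ->
  exists2 x, m < x & forall b, b \in t -> x < b.
Proof.
elim: t => [_|b t IH mt]; first by exists (m + 1); rewrite ?ltrDl.
have [|x mx xt] := IH; first by move=> b' tb'; rewrite mt // inE tb' orbT.
have mb : m < b by rewrite mt ?mem_head.
exists (Num.min x ((m + b) / 2)) => [|b']; first by rewrite lt_min mx midf_lt.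
rewrite inE gt_min => /predU1P[->|/xt->//]; by rewrite [X in _ || X]midf_lt ?orbT.
Qed.

Lemma seq_separation (a0 : R) (s t : seq R) :
    (forall a b, a \in a0 :: s -> b \in t -> a < b) ->
  exists x, (forall a, a \in a0 :: s -> a < x) /\ (forall b, b \in t -> x < b).
Proof.
elim: s a0 => [|a1 s IH] a0 st.
  have [|x a0x xt] := @seq_gap a0 t; first by move=> b; apply: st; rewrite mem_head.
  by exists x; split=> // a; rewrite inE => /eqP->.
have [|x [sx xt]] := IH (Num.max a0 a1).
  move=> a b; rewrite inE => /predU1P[->|sa] tb.
    by rewrite gt_max !st // !inE eqxx ?orbT.
  by apply: st => //; rewrite !inE sa !orbT.
have := sx _ (mem_head _ _); rewrite gt_max => /andP[a0x a1x].
exists x; split=> // a; rewrite !inE => /or3P[/eqP->|/eqP->|sa] //.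
by rewrite sx // inE sa orbT.
Qed.

Lemma bform_diag_delta k (d : 'rV[R]_k) i j :
  bform (diag_mx d) (delta_mx i 0) (delta_mx j 0) = d 0 i *+ (i == j).
Proof. by rewrite /bform trmx_delta -rowE -colE !mxE. Qed.

(** In a diagonalizing basis the goal is [d_i - a e_i > 0] for all [i]. Negative [e_i] bound [a]
    from below by [d_i / e_i], positive ones bound it from above, and zero ones only require
    [d_i > 0]. *)
Lemma strict_S_lemma n (F G : 'M[R]_n) :
    symmx F -> symmx G ->
    (forall x : 'cV_n, x != 0 -> 0 <= bform G x x -> 0 < bform F x x) ->
  exists2 a, 0 < a & pdmx (F - a *: G).
Proof.
move=> sF sG FG.
have [|P [d [e [uP PF PG]]]] := simultaneous_diagonalization sF sG.
  by move=> x xn0 Gx; rewrite FG // Gx.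
have FP y : bform F (P *m y) (P *m y) = bform (diag_mx d) y y.
  by rewrite -PF bform_mul trmxK.
have GP y : bform G (P *m y) (P *m y) = bform (diag_mx e) y y.
  by rewrite -PG bform_mul trmxK.
have DE (y : 'cV_n) : y != 0 -> 0 <= bform (diag_mx e) y y -> 0 < bform (diag_mx d) y y.
  move=> yn0; rewrite -FP -GP; apply: FG; apply: contraNneq yn0 => Py.
  by rewrite -(mulKmx uP y) Py mulmx0.
have d_gt0 i : 0 <= e 0 i -> 0 < d 0 i.
  move=> ei; have := DE (delta_mx i 0); rewrite !bform_diag_delta eqxx; apply=> //.
  by apply/eqP => /matrixP/(_ i 0)/eqP; rewrite !mxE !eqxx oner_eq0.
(* Every lower bound lies below every upper bound: test the hypothesis on a vector of two
   coordinates, weighted so that the form of [e] vanishes on it. *)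
have cross i j : e 0 i < 0 -> 0 < e 0 j -> d 0 j * e 0 i < d 0 i * e 0 j.
  move=> ei ej; have ij : i == j = false.
    by apply/negP => /eqP ij; move: ej; rewrite -ij ltNge ltW.
  pose y : 'cV_n := Num.sqrt (e 0 j) *: delta_mx i 0 + Num.sqrt (- e 0 i) *: delta_mx j 0.
  have Y (h : 'rV_n) : bform (diag_mx h) y y = h 0 i * e 0 j - h 0 j * e 0 i.
    rewrite !(bformDl, bformDr, bformZl, bformZr) !bform_diag_delta !eqxx.
    rewrite [j == i]eq_sym ij !mulr0n !mulr1n !(mulr0, addr0, add0r) !mulrA -!expr2.
    by rewrite !sqr_sqrtr ?oppr_ge0 ?ltW //; ring.
  have : 0 < bform (diag_mx d) y y; last by rewrite Y subr_gt0.
  apply: DE; last by rewrite Y mulrC subrr.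
  apply/eqP => /matrixP/(_ j 0)/eqP.
  rewrite !mxE !eqxx [j == i]eq_sym ij /= mulr0 add0r mulr1 sqrtr_eq0.
  by rewrite oppr_le0 leNgt ei.
pose s := [seq d 0 i / e 0 i | i <- enum 'I_n & e 0 i < 0].
pose t := [seq d 0 i / e 0 i | i <- enum 'I_n & 0 < e 0 i].
(* The extra lower bound 0 makes [a] positive. It is below every upper bound because [d_j > 0]
   whenever [e_j > 0]. *)
have [|a [sa at_]] := @seq_separation 0 s t.
  move=> x y; rewrite inE => sx /mapP[j]; rewrite mem_filter => /andP[ej _] ->.
  case/predU1P: sx => [->|/mapP[i si ->]]; first by rewrite divr_gt0 ?d_gt0 ?ltW.
  move: si; rewrite mem_filter => /andP[ei _].
  by rewrite ltr_pdivlMr // mulrAC ltr_ndivrMr // cross.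
exists a; first by rewrite sa ?mem_head.
split=> [|x xn0]; first by rewrite /symmx linearB linearZ /= sF sG.
rewrite -/(bform _ x x) -(mulKVmx uP x) bformBm bformZm FP GP -bformZm -bformBm.
rewrite -linearZ -linearB; apply: bform_diag_gt0 => [i|]; last first.
  by apply: contraNneq xn0 => Px; rewrite -(mulKVmx uP x) Px mulmx0.
rewrite !mxE subr_gt0; case: (ltrgt0P (e 0 i)) => ei.
- rewrite -ltr_pdivlMr //; apply: at_; apply/mapP.
  by exists i; rewrite // mem_filter ei mem_enum.
- rewrite -ltr_ndivrMr //; apply: sa; rewrite inE; apply/orP; right; apply/mapP.
  by exists i; rewrite // mem_filter ei mem_enum.
- by rewrite ei mulr0 d_gt0 ?ei.
Qed.

End SLemma.

(** * The quadratic form of the data and the matrix S-lemma *)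

Section DataForm.
Variable R : rcfType.

(** At [(x, G^T x)] the form takes the value [x^T (c I - W W^T) x] with [W = Y - G Z]. *)
Definition noise_form n p L (c : R) (Y : 'M[R]_(n, L)) (Z : 'M[R]_(p, L))
    : 'M[R]_(n + p) :=
  block_mx (c%:M - Y *m Y^T) (Y *m Z^T) (Z *m Y^T) (- (Z *m Z^T)).

Lemma Nc_noise_form n m q L c (X : 'M[R]_(n, L)) (U : 'M_(m, L)) (V : 'M_(q, L))
    (E : 'M_(n, q)) (D11 : 'M_L) :
  Nc c X U V E D11 = noise_form c (X *m D11 - E *m V) (col_mx X U).
Proof.
rewrite /Nc /noise_form; set Y := _ - _; set Z := col_mx X U.
have -> : col_mx (row_mx 0 (- X)) (row_mx 0 (- U)) = row_mx (0 : 'M_(n + m, n)) (- Z).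
  by rewrite /Z opp_col_mx -[LHS]/(block_mx _ _ _ _) block_mxEh col_mx0.
rewrite -[col_mx (row_mx _ _) _]/(block_mx _ _ _ _) tr_block_mx !mulmx_block.
rewrite !(trmx0, trmx1, mul0mx, mulmx0, addr0, add0r, mul1mx, mulmx1).
by rewrite [(- Z)^T]linearN /= !(mulmxN, mulNmx) !mulmx1 !opprK.
Qed.

Lemma sym_noise_form n p L c (Y : 'M[R]_(n, L)) (Z : 'M_(p, L)) :
  symmx (noise_form c Y Z).
Proof.
rewrite /symmx tr_block_mx linearB linearN /= !trmx_mul !trmxK tr_scalar_mx.
by [].
Qed.

Lemma bform_mul_tr p k l (A : 'M[R]_(p, l)) (B : 'M_(k, l)) x y :
  bform (A *m B^T) x y = bform 1%:M (A^T *m x) (B^T *m y).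
Proof. by rewrite -[A in LHS]mulmx1 bform_mul. Qed.

Lemma bform_mull p k p' (S : 'M[R]_(p, p')) (M : 'M_(p', k)) x y :
  bform (S *m M) x y = bform M (S^T *m x) y.
Proof. by rewrite /bform trmx_mul trmxK !mulmxA. Qed.

Lemma bform0m p k x y : bform (0 : 'M[R]_(p, k)) x y = 0.
Proof. by rewrite -(subrr 0) bformBm subrr. Qed.

Lemma bform_scalar k (a : R) (x y : 'cV_k) : bform a%:M x y = a * bform 1%:M x y.
Proof. by rewrite -[a%:M]scalemx1 bformZm. Qed.

Lemma sym1 k : symmx (1%:M : 'M[R]_k).
Proof. exact: trmx1. Qed.

Lemma noise_formE n p L c (Y : 'M[R]_(n, L)) (Z : 'M_(p, L)) x w :
  bform (noise_form c Y Z) (col_mx x w) (col_mx x w) =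
  c * bform 1%:M x x - bform 1%:M (Y^T *m x - Z^T *m w) (Y^T *m x - Z^T *m w).
Proof.
rewrite bform_block bformBm bformNm !bform_mul_tr bform_scalar.
rewrite -[- (Z^T *m w)]scaleN1r !(bformDl, bformDr, bformZl, bformZr).
by rewrite (bform_symC (Z^T *m w) _ (@sym1 _)); ring.
Qed.

Lemma cauchy_schwarz k (S : 'M[R]_k) (x z : 'cV_k) :
    symmx S -> (forall y : 'cV_k, 0 <= bform S y y) -> 0 < bform S x x ->
  bform S x z ^+ 2 / bform S x x <= bform S z z.
Proof.
move=> sS S_ge0 Sxx; set s := bform S x x in Sxx *; set b := bform S x z.
have := S_ge0 (z + (- (b / s)) *: x).
rewrite !(bformDl, bformDr, bformZl, bformZr) (bform_symC z x sS) -/s -/b.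
set e := (X in 0 <= X); suff -> : e = bform S z z - b ^+ 2 / s by rewrite subr_ge0.
by rewrite /e; field; rewrite gt_eqF.
Qed.

Lemma pdmx_unit k (S : 'M[R]_k) : (forall x : 'cV_k, x != 0 -> 0 < bform S x x) ->
  S \in unitmx.
Proof.
move=> S_gt0; rewrite -row_free_unit -kermx_eq0; apply/rowV0P => y /sub_kermxP yS.
apply/eqP/negPn/negP => yn0; have := S_gt0 y^T; rewrite trmx_eq0 => /(_ yn0).
by rewrite /bform trmxK yS mul0mx mxE ltxx.
Qed.

Lemma row_free_gram_gt0 r L (Z : 'M[R]_(r, L)) (w : 'cV_r) :
  row_free Z -> w != 0 -> 0 < bform (Z *m Z^T) w w.
Proof.
case/row_freeP => Z' ZZ' wn0; rewrite bform_mul_tr bform1_gt0 //.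
apply: contraNneq wn0 => Zw; rewrite -(mul1mx w) -trmx1 -ZZ' trmx_mul -mulmxA Zw.
by rewrite mulmx0.
Qed.

(** Completing the square in [w] writes the form as [S(x) - K(w - C x)], where [K] is the Gram
    matrix of [Z] and [S] is positive definite by the Slater condition. Starting from the centre
    [C], a rank-one term steers [x] to [w], and Cauchy-Schwarz for [S] keeps the form nonnegative
    everywhere else. *)
Lemma noise_form_interpolation n r L c (Y : 'M[R]_(n, L)) (Z : 'M_(r, L))
    (G0 : 'M_(n, r)) (x : 'cV_n) (w : 'cV_r) :
    row_free Z ->
    (forall z : 'cV_n, z != 0 ->
      0 < bform (noise_form c Y Z) (col_mx z (G0^T *m z)) (col_mx z (G0^T *m z))) ->
    x != 0 -> 0 <= bform (noise_form c Y Z) (col_mx x w) (col_mx x w) ->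
  exists G : 'M_(n, r), G^T *m x = w /\ forall z,
    0 <= bform (noise_form c Y Z) (col_mx z (G^T *m z)) (col_mx z (G^T *m z)).
Proof.
move=> Zfree slater xn0; set K := Z *m Z^T.
have K_gt0 (v : 'cV_r) : v != 0 -> 0 < bform K v v by apply: row_free_gram_gt0.
have K_ge0 (v : 'cV_r) : 0 <= bform K v v.
  by have [->|/K_gt0/ltW//] := eqVneq v 0; rewrite bform0l.
have uK := pdmx_unit K_gt0.
have sK : symmx K by rewrite /symmx trmx_mul trmxK.
pose C := invmx K *m Z *m Y^T.
(* [S] is the Schur complement of the block [- K]. *)
pose S := c%:M - Y *m Y^T + Y *m Z^T *m invmx K *m Z *m Y^T.
have sS : symmx S.
  rewrite /symmx linearD linearB /= tr_scalar_mx !trmx_mul !trmxK trmx_inv sK.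
  by rewrite !mulmxA.
have square z v : bform (noise_form c Y Z) (col_mx z v) (col_mx z v) =
    bform S z z - bform K (v - C *m z) (v - C *m z).
  have KC : K *m C = Z *m Y^T by rewrite /C !mulmxA mulmxV ?mul1mx.
  have KCz u : bform K u (C *m z) = bform (Z *m Y^T) u z.
    by rewrite -bform_mulr KC.
  have CKC : bform (Z *m Y^T) (C *m z) z =
      bform (Y *m Z^T *m invmx K *m Z *m Y^T) z z.
    rewrite -[C in LHS]trmxK -bform_mull; congr (bform _ _ _).
    by rewrite !trmx_mul !trmxK trmx_inv sK !mulmxA.
  have YZ : bform (Y *m Z^T) z v = bform (Z *m Y^T) v z.
    by rewrite -[LHS]bform_tr trmx_mul trmxK.
  rewrite bform_block /S !bformDm !bformNm -/K YZ -CKC -[- (C *m z)]scaleN1r.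
  rewrite !(bformDl, bformDr, bformZl, bformZr) (bform_symC (C *m z) v sK) !KCz.
  ring.
have S_gt0 z : z != 0 -> 0 < bform S z z.
  move=> zn0; apply: lt_le_trans (slater z zn0) _.
  by rewrite square lerBlDr lerDl K_ge0.
have S_ge0 (z : 'cV_n) : 0 <= bform S z z.
  by have [->|/S_gt0/ltW//] := eqVneq z 0; rewrite bform0l.
have Sxx := S_gt0 x xn0; rewrite square subr_ge0.
set s := bform S x x in Sxx *; set d := w - C *m x => Kd.
(* The correction is proportional to [S(x, z)], normalized to equal [d] at [z = x]. *)
pose G := (C + s^-1 *: (d *m (S *m x)^T))^T.
have Gz z : G^T *m z = C *m z + (bform S x z / s) *: d.
  rewrite trmxK mulmxDl -scalemxAl trmx_mul sS -(mulmxA d).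
  by rewrite [x^T *m S *m z]mx11_scalar mul_mx_scalar scalerA mulrC.
exists G; split=> [|z].
  by rewrite Gz -/s divff ?gt_eqF // scale1r addrC subrK.
rewrite Gz square [C *m z + _]addrC addrK bformZl bformZr subr_ge0.
apply: le_trans (cauchy_schwarz z sS S_ge0 Sxx); rewrite -/s.
set t := bform S x z / s; have -> : bform S x z ^+ 2 / s = t ^+ 2 * s.
  by rewrite /t; field; rewrite gt_eqF.
by rewrite mulrA -expr2 ler_wpM2l ?sqr_ge0.
Qed.

Lemma reduced_S_lemma n r L c (Y : 'M[R]_(n, L)) (Z : 'M_(r, L))
    (Th : 'M_(r, n)) (G0 : 'M_(n, r)) :
    row_free Z ->
    (forall z : 'cV_n, z != 0 ->
      0 < bform (noise_form c Y Z) (col_mx z (G0^T *m z)) (col_mx z (G0^T *m z))) ->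
    (forall G : 'M_(n, r), (forall z,
        0 <= bform (noise_form c Y Z) (col_mx z (G^T *m z)) (col_mx z (G^T *m z))) ->
      forall x, x != 0 -> bform Th (G^T *m x) x < 0) ->
  exists a b, [/\ 0 < a, 0 < b & forall (x : 'cV_n) (w : 'cV_r),
    0 <= - b * bform 1%:M x x - 2 * bform Th w x
         - a * bform (noise_form c Y Z) (col_mx x w) (col_mx x w)].
Proof.
move=> Zfree slater stab.
pose F : 'M_(n + r) := block_mx 0 (- Th^T) (- Th) 0.
have FE x w : bform F (col_mx x w) (col_mx x w) = - (2 * bform Th w x).
  by rewrite bform_block !bformNm bform_tr !bform0m; ring.
have sF : symmx F.
  by rewrite /symmx tr_block_mx !linear0 !linearN /= trmxK.
(* The first use of the S-lemma gives [a]. A nonzero pair with nonnegative data form has [x]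
   nonzero, since at [x = 0] the form is [- |Z^T w|^2] and [Z] has full row rank. *)
have [|a a_gt0 /pdmxP[sFa Fa_gt0]] := strict_S_lemma sF (sym_noise_form c Y Z).
  move=> xi; rewrite -[xi]vsubmxK; move: (usubmx xi) (dsubmx xi) => x w xw0 Nxw.
  have xn0 : x != 0.
    apply: contraNneq xw0 => x0; move: Nxw; rewrite x0 noise_formE bform0l mulr0.
    rewrite mulmx0 !sub0r -[- (Z^T *m w)]scaleN1r bformZl bformZr.
    rewrite mulrA mulrNN mulr1 mul1r.
    rewrite -bform_mul_tr; have [->|wn0] := eqVneq w 0; first by rewrite col_mx0.
    by rewrite oppr_ge0 leNgt row_free_gram_gt0.
  have [G [Gx Gge0]] := noise_form_interpolation Zfree slater xn0 Nxw.
  by have := stab G Gge0 x xn0; rewrite Gx FE; lra.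
(* The second use gives [b]: with [I] as the constraint form, the implication holds because
   [F - a N] is already positive definite, [N] being the data form. *)
pose I : 'M[R]_(n + r) := block_mx 1%:M 0 0 0.
have sI : symmx I by rewrite /symmx tr_block_mx !linear0 trmx1.
have [|b b_gt0 /pdmxP[_ Fb_gt0]] := strict_S_lemma sFa sI.
  by move=> x xn0 _; apply: Fa_gt0.
exists a, b; split=> // x w.
have [xw0|xwn0] := eqVneq (col_mx x w) 0.
  move/eqP: (xw0); rewrite col_mx_eq0 => /andP[/eqP-> /eqP->].
  by rewrite col_mx0 !bform0l !mulr0 !subr0.
have := ltW (Fb_gt0 _ xwn0); rewrite !bformBm !bformZm FE.
have -> : bform I (col_mx x w) (col_mx x w) = bform 1%:M x x.
  by rewrite bform_block !bform0m !addr0.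
by move=> ge0; lra.
Qed.

(** Moving [G0^T] along the kernel of [Z^T] leaves the data form unchanged, while the Lyapunov term
    gains [t |W x|^2] for any [t >= 0]. Staying negative forces [W = 0], so the columns of [H] lie
    in the column space of [Z]. *)
Lemma stabilizer_row_space n p L c (Y : 'M[R]_(n, L)) (Z : 'M_(p, L))
    (H : 'M_(p, n)) (G0 : 'M_(n, p)) :
    (forall z,
      0 <= bform (noise_form c Y Z) (col_mx z (G0^T *m z)) (col_mx z (G0^T *m z))) ->
    (forall G : 'M_(n, p), (forall z,
        0 <= bform (noise_form c Y Z) (col_mx z (G^T *m z)) (col_mx z (G^T *m z))) ->
      forall x, x != 0 -> bform H (G^T *m x) x < 0) ->
  exists D : 'M_(L, n), H = Z *m D.
Proof.
move=> G0_ge0 stab; pose O := cokermx Z^T; pose W := O^T *m H.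
have ZO : Z^T *m O = 0 := mulmx_coker _.
have ray t (x : 'cV_n) : x != 0 -> 0 <= t ->
    bform H (G0^T *m x) x + t * bform 1%:M (W *m x) (W *m x) < 0.
  move=> xn0 t_ge0; pose G := (G0^T + t *: (O *m W))^T.
  have Gz z : G^T *m z = G0^T *m z + t *: (O *m (W *m z)).
    by rewrite trmxK mulmxDl -scalemxAl mulmxA.
  have := stab G _ x xn0; rewrite Gz bformDl bformZl.
  rewrite -[bform H (O *m _) x]bform_tr.
  have -> : bform H^T x (O *m (W *m x)) = bform 1%:M (W *m x) (W *m x).
    by rewrite -bform_mulr -[RHS]bform_mulr mul1mx -[RHS]bform_tr trmx_mul trmxK.
  apply=> z; rewrite noise_formE Gz mulmxDr -scalemxAr.
  rewrite (mulmxA _ O) ZO mul0mx scaler0 addr0.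
  by rewrite -noise_formE.
have Wx (x : 'cV_n) : W *m x = 0.
  apply/eqP/negPn/negP => Wxn0; have Wx_gt0 := bform1_gt0 Wxn0.
  have xn0 : x != 0 by apply: contraNneq Wxn0 => ->; rewrite mulmx0.
  (* This [t] makes the gain equal to the absolute value of the term at [G0], so the sum cannot be
     negative. *)
  have := ray (`|bform H (G0^T *m x) x| / bform 1%:M (W *m x) (W *m x)) x xn0.
  rewrite divfK ?gt_eqF // divr_ge0 ?normr_ge0 ?bform1_ge0 // => /(_ isT).
  by rewrite ltNge -lerBlDl sub0r -normrN ler_norm.
have HO : H^T *m O = 0.
  apply: trmx_inj; rewrite trmx_mul trmxK trmx0; apply/matrixP => i j.
  by have /matrixP/(_ i 0) := Wx (delta_mx j 0); rewrite -colE !mxE.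
have /submxP[D HD] : (H^T <= Z^T)%MS by rewrite submxE HO.
by exists D^T; rewrite -[LHS]trmxK HD trmx_mul trmxK.
Qed.

(** A full-rank factorization [Z = T Z1] reduces to full row rank. Both forms see [w] only through
    [T^T w], and a left inverse [T'] of [T] lifts a reduced [G] to [G T']. *)
Lemma matrix_S_lemma n p L c (Y : 'M[R]_(n, L)) (Z : 'M_(p, L))
    (H : 'M_(p, n)) (G0 : 'M_(n, p)) :
    (forall z : 'cV_n, z != 0 ->
      0 < bform (noise_form c Y Z) (col_mx z (G0^T *m z)) (col_mx z (G0^T *m z))) ->
    (forall G : 'M_(n, p), (forall z,
        0 <= bform (noise_form c Y Z) (col_mx z (G^T *m z)) (col_mx z (G^T *m z))) ->
      forall x, x != 0 -> bform H (G^T *m x) x < 0) ->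
  exists a b, [/\ 0 < a, 0 < b & forall (x : 'cV_n) (w : 'cV_p),
    0 <= - b * bform 1%:M x x - 2 * bform H w x
         - a * bform (noise_form c Y Z) (col_mx x w) (col_mx x w)].
Proof.
move=> slater stab.
have [z|//|D HD] := @stabilizer_row_space _ _ _ c Y Z H G0.
  have [->|/slater/ltW//] := eqVneq z 0.
  by rewrite mulmx0 col_mx0 bform0l.
pose T := col_base Z; pose Z1 := row_base Z; pose Th := Z1 *m D.
have ZE : Z = T *m Z1 by rewrite mulmx_base.
have HE : H = T *m Th by rewrite /Th mulmxA -ZE.
have [T' T'T] := row_fullP (col_base_full Z).
have NE x w : bform (noise_form c Y Z) (col_mx x w) (col_mx x w) =
    bform (noise_form c Y Z1) (col_mx x (T^T *m w)) (col_mx x (T^T *m w)).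
  by rewrite !noise_formE mulmxA -trmx_mul -ZE.
have [z zn0||a [b [a_gt0 b_gt0 ab]]] :=
    @reduced_S_lemma _ _ _ c Y Z1 Th (G0 *m T) (row_base_free Z).
- by rewrite trmx_mul -mulmxA -NE slater.
- move=> G G_ge0 x xn0.
  have GE z : T^T *m ((G *m T')^T *m z) = G^T *m z.
    by rewrite mulmxA -trmx_mul -mulmxA T'T mulmx1.
  rewrite -GE -bform_mull -HE; apply: stab => // z.
  by rewrite NE GE.
by exists a, b; split=> // x w; rewrite HE bform_mull NE.
Qed.

End DataForm.

(** * Data set, matrix inequality and Lyapunov condition as quadratic forms *)

Section Stabilization.
Variable R : rcfType.

Lemma pdmx_invmx k (M : 'M[R]_k) : pdmx M -> pdmx (invmx M).
Proof.
case/pdmxP=> sM M_gt0; have uM := pdmx_unit M_gt0.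
split=> [|x xn0]; first by rewrite /symmx trmx_inv sM.
have : M *m invmx M *m x != 0 by rewrite mulmxV // mul1mx.
rewrite -mulmxA => Mx; have y0 : invmx M *m x != 0.
  by apply: contraNneq Mx => ->; rewrite mulmx0.
have := M_gt0 _ y0; rewrite -{1}[invmx M]trmxK -bform_mul trmx_inv sM.
by rewrite mulVmx // mul1mx.
Qed.

Lemma IAB_form n m (A : 'M[R]_n) (B : 'M_(n, m)) (N : 'M_(n + (n + m))) x :
  bform (IAB A B *m N *m (IAB A B)^T) x x =
  bform N (col_mx x ((row_mx A B)^T *m x)) (col_mx x ((row_mx A B)^T *m x)).
Proof. by rewrite bform_mul /IAB (tr_row_mx 1%:M) mul_col_mx trmx1 mul1mx. Qed.

Lemma SigmaP n m q L c (X : 'M[R]_(n, L)) (U : 'M_(m, L)) (V : 'M_(q, L))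
    (E : 'M_(n, q)) (D11 : 'M_L) A B :
  let N := noise_form c (X *m D11 - E *m V) (col_mx X U) in
  Sigma c X U V E D11 A B <-> forall z,
    0 <= bform N (col_mx z ((row_mx A B)^T *m z)) (col_mx z ((row_mx A B)^T *m z)).
Proof.
rewrite /= -Nc_noise_form /Sigma; split=> [[_ N_ge0] z | N_ge0].
  by rewrite -IAB_form; apply: N_ge0.
split=> [|z]; last by rewrite -/(bform _ z z) IAB_form.
by rewrite /symmx Nc_noise_form !trmx_mul trmxK sym_noise_form mulmxA.
Qed.

Lemma LMI_formE n m q L c (X : 'M[R]_(n, L)) (U : 'M_(m, L)) (V : 'M_(q, L))
    (E : 'M_(n, q)) (D11 : 'M_L) a b (P : 'M_n) (J : 'M_(m, n)) x w : symmx P ->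
  bform (LMI c X U V E D11 a b P J) (col_mx x w) (col_mx x w) =
  - b * bform 1%:M x x - 2 * bform (col_mx P J) w x
  - a * bform (noise_form c (X *m D11 - E *m V) (col_mx X U)) (col_mx x w) (col_mx x w).
Proof.
move=> sP; rewrite /LMI bformBm bformZm Nc_noise_form; congr (_ - _).
have -> : row_mx (- P) (- J^T) = - (col_mx P J)^T.
  by rewrite tr_col_mx sP opp_row_mx.
rewrite -opp_col_mx bform_block !bformNm bform_tr bform0m bform_scalar; ring.
Qed.

Lemma sym_LMI n m q L c (X : 'M[R]_(n, L)) (U : 'M_(m, L)) (V : 'M_(q, L))
    (E : 'M_(n, q)) (D11 : 'M_L) a b (P : 'M_n) (J : 'M_(m, n)) : symmx P ->
  symmx (LMI c X U V E D11 a b P J).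
Proof.
move=> sP; rewrite /symmx /LMI linearB linearZ /= Nc_noise_form sym_noise_form.
rewrite tr_block_mx tr_row_mx tr_col_mx linear0 !linearN /= trmxK sP.
by rewrite tr_scalar_mx.
Qed.

(** Congruence by [P] turns the Lyapunov matrix into the symmetric matrix of [2 x^T (A P + B J) x],
    and [A P + B J] is [[A B]] times [[P; J]]. The condition is thus linear in [(P, J)]. *)
Lemma lyapunov_form n m (A : 'M[R]_n) (B : 'M_(n, m)) (P : 'M_n) (J : 'M_(m, n)) :
    pdmx P ->
  ndmx ((A + B *m (J *m invmx P))^T *m invmx P
        + invmx P *m (A + B *m (J *m invmx P))) <->
  forall x, x != 0 -> bform (col_mx P J) ((row_mx A B)^T *m x) x < 0.
Proof.
case/pdmxP=> sP P_gt0; have uP := pdmx_unit P_gt0.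
have siP : (invmx P)^T = invmx P by rewrite trmx_inv sP.
set M := A + B *m (J *m invmx P); set N := M^T *m invmx P + invmx P *m M.
have NE x : bform (- N) (P *m x) (P *m x) =
    - (2 * bform (col_mx P J) ((row_mx A B)^T *m x) x).
  have -> : bform (col_mx P J) ((row_mx A B)^T *m x) x =
      bform (invmx P *m M) (P *m x) (P *m x).
    rewrite -bform_mull mul_row_col -[LHS]/(bform _ x x) [in RHS]bform_mull siP mulKmx //.
    rewrite -bform_mulr mulmxDl -!mulmxA mulVmx // mulmx1 //.
  rewrite bformNm bformDm -[bform (M^T *m _) _ _]bform_tr trmx_mul trmxK siP; ring.
have Pn0 (x : 'cV_n) : x != 0 -> P *m x != 0.
  by apply: contraNneq => Px; rewrite -(mulKmx uP x) Px mulmx0.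
split=> [[_ N_gt0] x xn0 | H_lt0].
  have := N_gt0 _ (Pn0 x xn0); rewrite -/(bform _ _ _) NE; lra.
split=> [|x xn0].
  by rewrite /symmx linearN linearD /= !trmx_mul trmxK siP addrC.
rewrite -/(bform _ x x) -(mulKVmx uP x) NE oppr_gt0 pmulr_rlt0 // H_lt0 //.
by apply: contraNneq xn0 => Px; rewrite -(mulKVmx uP x) Px mulmx0.
Qed.

End Stabilization.

Unset Implicit Arguments.

Theorem theorem6 (R : rcfType) (n m q L : nat) (c : R)
  (X : 'M[R]_(n, L)) (U : 'M[R]_(m, L)) (V : 'M[R]_(q, L))
  (E : 'M[R]_(n, q)) (D11 : 'M[R]_L) (Abar : 'M[R]_n) (Bbar : 'M[R]_(n, m)) :
  (0 < n)%N -> (0 < m)%N -> (0 < q)%N -> (0 < L)%N -> 0 < c ->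
  pdmx (IAB Abar Bbar *m Nc c X U V E D11 *m (IAB Abar Bbar)^T) ->
  (informative_qs c X U V E D11 <->
     exists (alpha beta : R) (P : 'M[R]_n) (J : 'M[R]_(m, n)),
       [/\ 0 <= alpha, 0 < beta, pdmx P &
           psdmx (LMI c X U V E D11 alpha beta P J)])
  /\
  (forall (alpha beta : R) (P : 'M[R]_n) (J : 'M[R]_(m, n)),
     0 <= alpha -> 0 < beta -> pdmx P ->
     psdmx (LMI c X U V E D11 alpha beta P J) ->
     forall A B, Sigma c X U V E D11 A B ->
       ndmx ((A + B *m (J *m invmx P))^T *m invmx P
             + invmx P *m (A + B *m (J *m invmx P)))).
Proof.
move=> _ _ _ _ _ slater.
(* Evaluated at [w = [A B]^T x], the inequality bounds [- 2 x^T (A P + B J) x] below by [b |x|^2]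
   plus [a] times a nonnegative data term. *)
have gain a b P J : 0 <= a -> 0 < b -> pdmx P -> psdmx (LMI c X U V E D11 a b P J) ->
    forall A B, Sigma c X U V E D11 A B ->
    ndmx ((A + B *m (J *m invmx P))^T *m invmx P
          + invmx P *m (A + B *m (J *m invmx P))).
  move=> a_ge0 b_gt0 pP [_ LMI_ge0] A B /SigmaP AB; apply/lyapunov_form => // x xn0.
  have := LMI_ge0 (col_mx x ((row_mx A B)^T *m x)).
  rewrite -/(bform _ _ _) LMI_formE; last by case: pP.
  have := mulr_ge0 a_ge0 (AB x); have := mulr_gt0 b_gt0 (bform1_gt0 xn0).
  by move=> ? ? ?; lra.
split=> //; split=> [[K [Q [pQ stab]]] | [a [b [P [J [a_ge0 b_gt0 pP psd]]]]]]; last first.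
  exists (J *m invmx P), (invmx P); split; first exact: pdmx_invmx.
  by move=> A B; apply: gain psd A B.
have uQ : Q \in unitmx by case/pdmxP: pQ => _ /pdmx_unit.
(* The certificate is [P = Q^-1] and [J = K P], so that [J P^-1] is again [K]. *)
have pP := pdmx_invmx pQ; set P := invmx Q in pP.
have [z zn0|G G_ge0 x xn0|a [b [a_gt0 b_gt0 ab]]] :=
    @matrix_S_lemma _ _ _ _ c (X *m D11 - E *m V) (col_mx X U) (col_mx P (K *m P))
      (row_mx Abar Bbar).
- by case: slater => _ /(_ z zn0); rewrite -/(bform _ z z) IAB_form Nc_noise_form.
- rewrite -[G]hsubmxK in G_ge0 *; apply: (proj1 (lyapunov_form _ _ _ pP)) => //.
  rewrite mulmxK ?unitmx_inv // /P invmxK.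
  by apply: stab; apply/SigmaP.
exists a, b, P, (K *m P); split=> //; first exact: ltW.
have sP : symmx P by case: pP.
split=> [|xi]; first exact: sym_LMI.
by rewrite -[xi]vsubmxK -/(bform _ _ _) LMI_formE.
Qed.
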